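(* For time periods $t$ and price nodes $i\in\mathcal N$, let $$Q_{t-1,i}(e_{t-1})=\max_{b_t,p_t}\ \pi_{t,i}(p_t-b_t)-c\,p_t+V_{t,i}(e_t),\qquad V_{t,i}(e_t)=\sum_{j\in\mathcal N}\rho_{i,j,t}\,Q_{t,j}(e_t),$$ where the maximization is subject to $0\le b_t\le P$, $0\le p_t\le P$; $p_t=0$ if the price is negative ($\pi_{t,i}<0$); $e_t-e_{t-1}=-p_t/\eta^p(e_{t-1})+b_t\,\eta^b(e_{t-1})$; and $0\le e_t\le E$. The efficiencies $\eta^p(\cdot)$ and $\eta^b(\cdot)$ are affine functions of the starting state of charge $e_{t-1}$. Let $q_{t-1,i}$ be the derivative of $Q_{t-1,i}$ and $v_{t,i}$ the derivative of $V_{t,i}$. Then, for a starting state of charge $e$, writing $\eta^p=\eta^p(e)$ and $\eta^b=\eta^b(e)$, $q_{t-1,i}$ is obtained from $v_{t,i}$ by $$q_{t-1,i}(e)=\begin{cases} v_{t,i}(e+P\eta^b) & \text{if } \pi_{t,i}\le v_{t,i}(e+P\eta^b)\,\eta^b,\\ \pi_{t,i}/\eta^b & \text{if } v_{t,i}(e+P\eta^b)\,\eta^b<\pi_{t,i}\le v_{t,i}(e)\,\eta^b,\\ v_{t,i}(e) & \text{if } v_{t,i}(e)\,\eta^b<\pi_{t,i}\le [v_{t,i}(e)/\eta^p+c]^+,\\ (\pi_{t,i}-c)\,\eta^p & \text{if } [v_{t,i}(e)/\eta^p+c]^+<\pi_{t,i}\le [v_{t,i}(e-P/\eta^p)/\eta^p+c]^+,\\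 v_{t,i}(e-P/\eta^p) & \text{if } \pi_{t,i}>[v_{t,i}(e-P/\eta^p)/\eta^p+c]^+. \end{cases}$$
   Context: Notation: $[x]^+=\max\{x,0\}$. This is one backward step of a stochastic dynamic program for energy storage price arbitrage in a real-time market. $P$ is the storage power rating, $E$ the energy capacity, $c$ the marginal discharge cost, $p_t$ the discharge and $b_t$ the charge in period $t$, $e_t$ the state of charge at the end of period $t$, and $\eta^p$, $\eta^b$ the discharge and charge efficiencies, which depend on the starting state of charge $e_{t-1}$ of the period. At each decision stage the starting state of charge is a given parameter and not a decision variable, so $\eta^p(e_{t-1})$ and $\eta^b(e_{t-1})$ are parameters of the one-stage maximization despite their dependence on the state of charge. Real-time prices are modelled by an order-1 Markov process: in period $t$ the price is one of the node values $\pi_{t,i}$, $i\in\mathcal N=\{1,\dots,N\}$, and $\rho_{i,j,t}$ is the probability of moving from $\pi_{t,i}$ to $\pi_{t+1,j}$. $Q_{t-1,i}(e_{t-1})$ is the maximized arbitrage profit from period $t$ to the end of the horizon when the starting state of charge is $e_{t-1}$ and the price node is $\pi_{t,i}$. $V_{t,i}(e_t)$ is the value-to-go function, that is, the opportunity value of the state of charge $e_t$ at the end of period $t$ at price node $\pi_{t,i}$; at the last period it is a prescribed final value-to-go function. The five cases of the formula correspond, in order, to the storage charging at full power $P$, charging at partial power between $0$ and $P$, neither charging nor discharging, discharging at partial power between $0$ and $P$, and discharging at full power $P$.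
   Formalization: Added: V_{t,i} concave on [0,E], c≥0, 0<η≤1. q is taken with efficiencies fixed at their values at e; v=+∞ below 0, −∞ above E, one-sided at 0, E. Excluded: π=0 with v(e)/η^p+c<0; e+Pη^b=E with π<v(E)η^b; e−P/η^p=0 with π>[v(0)/η^p+c]^+. *)

(* Defs.v *)
From HB Require Import structures.
From mathcomp Require Import all_boot all_order all_algebra.
From mathcomp Require Import all_classical all_reals all_analysis.
Set Implicit Arguments.
Unset Strict Implicit.
Unset Printing Implicit Defensive.
Import Order.TTheory GRing.Theory Num.Theory.
Import numFieldNormedType.Exports.

Local Open Scope classical_set_scope.
Local Open Scope ring_scope.

Definition affine_fun (R : realType) (f : R -> R) : Prop :=
  exists a b : R, forall x, f x = a * x + b.

Definition concave_on (R : realType) (A : set R) (f : R -> R) : Prop :=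
  @convex_function R R^o A (fun x => - f x).

(* Derivative of a function on [0, E]: the usual two-sided derivative at
   interior points, the one-sided derivative at 0 and at E. *)
Definition is_derivative_on (R : realType) (E : R) (f : R -> R) (x l : R)
  : Prop :=
  (f y - f x) / (y - x) @[y --> within `[0, E] x^'] --> l.

(* l is the derivative at x of a value-to-go function with domain [0, E].
   Outside the domain no state of charge is feasible, i.e. the concave function
   takes the value -oo there, and its slope is read as +oo below 0 and as -oo
   above E. *)
Definition is_marginal_value (R : realType) (E : R) (V : R -> R) (x : R)
    (l : \bar R) : Prop :=
  if x < 0 then l = +oo%E
  else if E < x then l = -oo%E
  else exists2 r : R, l = r%:E & is_derivative_on E V x r.

Definition is_max (R : realType) (A : set R) (m : R) : Prop :=
  A m /\ ubound A m.

Definition next_soc (R : realType) (etap etab x b p : R) : R :=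
  x - p / etap + b * etab.

Definition feasible (R : realType) (P E price etap etab x b p : R) : Prop :=
  [/\ 0 <= b <= P, 0 <= p <= P, price < 0 -> p = 0
    & 0 <= next_soc etap etab x b p <= E].

(* The profits attainable in one stage from the state of charge x, where the
   efficiencies etap and etab are numbers. *)
Definition stage_profits (R : realType) (P E c price etap etab : R)
    (V : R -> R) (x : R) : set R :=
  [set z | exists b p : R, feasible P E price etap etab x b p /\
     z = price * (p - b) - c * p + V (next_soc etap etab x b p)].

(* Q t i s x is the optimal profit of period t+1 up to the horizon from the
   state of charge x, when the efficiencies of period t+1 are the parameters
   etap s and etab s. The profit function of the dynamic program, whose
   efficiencies are those at the starting state of charge, is thus the diagonal
   fun e => Q t i e e, and it is the diagonal that enters V. The two arguments
   are separated so that one can differentiate in the starting state of charge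
   with the efficiencies held fixed. V T is unconstrained: it is the prescribed
   final value-to-go function. *)
Definition dynamic_program (R : realType) (N T : nat) (P E c : R)
    (etap etab : R -> R) (price : nat -> 'I_N -> R)
    (rho : nat -> 'I_N -> 'I_N -> R)
    (Q : nat -> 'I_N -> R -> R -> R) (V : nat -> 'I_N -> R -> R) : Prop :=
  (forall t i s x, (0 < t <= T)%N -> 0 <= s <= E -> 0 <= x <= E ->
     is_max (stage_profits P E c (price t i) (etap s) (etab s) (V t i) x)
            (Q t.-1 i s x)) /\
  (forall t i e, (0 < t < T)%N -> 0 <= e <= E ->
     V t i e = \sum_(j < N) rho t i j * Q t j e e).

(* [v / etap + c]^+ *)
Definition discharge_threshold (R : realType) (c etap : R) (v : \bar R)
  : \bar R :=
  maxe (v * (etap^-1)%:E + c%:E)%E 0%E.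

Definition marginal_update (R : realType) (P c price etap etab : R)
    (v : R -> \bar R) (e : R) : \bar R :=
  (if price%:E <= v (e + P * etab)%R * etab%:E then v (e + P * etab)%R
   else if price%:E <= v e * etab%:E then (price / etab)%:E
   else if price%:E <= discharge_threshold c etap (v e) then v e
   else if price%:E <= discharge_threshold c etap (v (e - P / etap)%R)
     then ((price - c) * etap)%:E
   else v (e - P / etap)%R)%E.

(* Main.v *)
Require Import Defs.
From HB Require Import structures.
From mathcomp Require Import all_boot all_order all_algebra.
From mathcomp Require Import all_classical all_reals all_analysis.
From mathcomp Require Import ring lra.
Import Order.TTheory GRing.Theory Num.Theory.
Import numFieldNormedType.Exports.
Local Open Scope classical_set_scope.
Local Open Scope ring_scope.

Set Implicit Arguments.
Unset Strict Implicit.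
Unset Printing Implicit Defensive.

(* Let y be an optimal next state of charge from e and s a supergradient at y of
   the concave function V such that s is also a multiplier for the constraints
   on the action. Weak duality gives Q x <= Q e + s (x - e) on [0, E]. From below,
   near e, one keeps the target y and changes only the power (partial power, or
   price ties), or one keeps the action and translates the target (full power or
   idle), where V has derivative s. Hence Q has derivative s at e. In the two
   partial-power cases s is fixed by the price and y comes from the optimal
   action at e, after replacing simultaneous charge and discharge, or a move in
   the wrong direction, by an action at least as good. *)

(** * Derivatives on [[0, E]] and supergradients *)

(** Clearing the denominator admits [y = x] and leaves inequalities that are linear in the values of
    [f]. *)
Lemma is_derivative_onP (R : realType) (E : R) (f : R -> R) (x l : R) :
  is_derivative_on E f x l <->
  forall eps : R, 0 < eps -> exists2 d : R, 0 < d &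
    forall y : R, 0 <= y <= E -> `|y - x| < d ->
      `|f y - f x - l * (y - x)| <= eps * `|y - x|.
Proof.
have quotientE y : y != x ->
    `|f y - f x - l * (y - x)| = `|l - (f y - f x) / (y - x)| * `|y - x|.
  move=> yx; rewrite -normrM distrC; congr `| _ |.
  by rewrite mulrBl divfK // subr_eq0.
split=> [/cvgrPdist_le df eps eps0 | df].
  have /nbhs_ballP[d /= d0 dP] := df eps eps0.
  exists d => // y yE yd; have [->|yx] := eqVneq y x.
    by rewrite !subrr mulr0 subrr normr0 mulr0.
  rewrite quotientE// ler_wpM2r//; apply: dP => //=.
  by rewrite /ball /= distrC.
apply/cvgrPdist_le => eps eps0; have [d d0 dP] := df eps eps0.
apply/nbhs_ballP; exists d => //= y /= yd yx; rewrite in_itv /= => yE.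
have {yd}yd : `|y - x| < d by rewrite distrC.
have := dP y yE yd; rewrite quotientE// ler_pM2r//.
by rewrite normr_gt0 subr_eq0.
Qed.

Definition supergradient (R : realType) (E : R) (f : R -> R) (x s : R) :=
  forall y : R, 0 <= y <= E -> f y <= f x + s * (y - x).

(** A short step from [x] towards [y] gains at least its share of the chord by concavity, and at
    most its share of the tangent up to a small error; divide by the step length. *)
Lemma concave_supergradient (R : realType) (E : R) (f : R -> R) (x l : R) :
  concave_on `[0, E] f -> 0 <= x <= E -> is_derivative_on E f x l ->
  supergradient E f x l.
Proof.
move=> cf xE /is_derivative_onP df y yE.
have [->|yx] := eqVneq y x; first by rewrite subrr mulr0 addr0.
have yx0 : 0 < `|y - x| by rewrite normr_gt0 subr_eq0.
apply/ler_addgt0Pr => eps eps0.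
have [d d0 dP] := df (eps / `|y - x|) (divr_gt0 eps0 yx0).
(* The cap at 1 makes [t] a convex weight; the other term brings the step length [t * |y - x|] below
   [d]. The tolerance [eps / |y - x|] turns into an error [t * eps]. *)
pose t := Num.min 1 (d / 2 / `|y - x|).
have t01 : 0 < t <= 1.
  by rewrite lt_min ltr01 divr_gt0 ?divr_gt0 //= ge_min lexx.
have td : t * `|y - x| < d.
  rewrite -ltr_pdivlMr// /t gt_min; apply/orP; right.
  by rewrite ltr_pM2r ?invr_gt0//; lra.
pose z := x + t * (y - x).
have zE : 0 <= z <= E by rewrite /z; nra.
have : t * f y + (1 - t) * f x <= f z.
  have t01' : 0 <= t <= 1 by lra.
  have ty : (y : R^o) \in (`[0, E]%classic : set R) by rewrite inE /= in_itv.
  have tx : (x : R^o) \in (`[0, E]%classic : set R) by rewrite inE /= in_itv.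
  have : - f (t * y + (1 - t) * x) <= t * - f y + (1 - t) * - f x :=
    cf (Itv01 (proj1 (andP t01')) (proj2 (andP t01'))) y x ty tx.
  have -> : t * y + (1 - t) * x = z by rewrite /z; ring.
  by lra.
have zx : z - x = t * (y - x) by rewrite /z; ring.
have := dP z zE; rewrite zx normrM (gtr0_norm (proj1 (andP t01))).
move=> /(_ td); rewrite [eps / _ * _]mulrCA divfK ?gt_eqF// ler_norml => /andP[_ fz] tf.
have : t * (f y) <= t * (f x + l * (y - x) + eps) by lra.
by rewrite ler_pM2l//; case/andP: t01.
Qed.

(** The comparison needs a point to the right of [x], hence [x < E]. The next lemma is its mirror
    image and tests a point to the left. *)
Lemma derivative_le_supergradient (R : realType) (E : R) (f : R -> R)
    (x l s : R) :
  0 <= x < E -> is_derivative_on E f x l -> supergradient E f x s -> l <= s.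
Proof.
move=> xE /is_derivative_onP df fs; apply/ler_addgt0Pr => eps eps0.
have [d d0 dP] := df eps eps0.
pose r := Num.min (d / 2) (E - x).
have r0 : 0 < r by rewrite lt_min; lra.
have rE : r <= E - x by rewrite ge_min lexx orbT.
have rd : r <= d / 2 by rewrite ge_min lexx.
have yE : 0 <= x + r <= E by lra.
have := dP _ yE; have := fs _ yE; rewrite addrAC subrr add0r gtr0_norm// => fr.
move=> /(_ ltac:(lra)); rewrite ler_norml => /andP[fr' _].
have : l * r <= (s + eps) * r by lra.
by rewrite ler_pM2r.
Qed.

Lemma supergradient_le_derivative (R : realType) (E : R) (f : R -> R)
    (x l s : R) :
  0 < x <= E -> is_derivative_on E f x l -> supergradient E f x s -> s <= l.
Proof.
move=> xE /is_derivative_onP df fs; apply/ler_addgt0Pr => eps eps0.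
have [d d0 dP] := df eps eps0.
pose r := Num.min (d / 2) x.
have r0 : 0 < r by rewrite lt_min; lra.
have rE : r <= x by rewrite ge_min lexx orbT.
have rd : r <= d / 2 by rewrite ge_min lexx.
have yE : 0 <= x - r <= E by lra.
have := dP _ yE; have := fs _ yE.
rewrite addrAC subrr add0r normrN gtr0_norm// => fr.
move=> /(_ ltac:(lra)); rewrite ler_norml => /andP[fr' _].
have : s * r <= (l + eps) * r by lra.
by rewrite ler_pM2r.
Qed.

(* A minorant of Q near e may follow the tangent line on some points and a
   translate of V on others; this covers the kinks in the optimal action. *)
Lemma derivative_sandwich (R : realType) (E : R) (V Q : R -> R)
    (e d s r : R) :
  0 < r -> supergradient E Q e s ->
  (forall x : R, 0 <= x <= E -> `|x - e| < r ->
     Q e + s * (x - e) <= Q x \/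
     [/\ is_derivative_on E V (e + d) s, 0 <= x + d <= E
       & Q e + (V (x + d) - V (e + d)) <= Q x]) ->
  is_derivative_on E Q e s.
Proof.
move=> r0 Qs lo; apply/is_derivative_onP => eps eps0.
have [d' d'0 d'P] : exists2 d' : R, 0 < d' & is_derivative_on E V (e + d) s ->
    forall y : R, 0 <= y <= E -> `|y - (e + d)| < d' ->
      `|V y - V (e + d) - s * (y - (e + d))| <= eps * `|y - (e + d)|.
  (* The radius must be fixed before [x], but the derivative of [V] is granted only in the second
     alternative. Its existence is decided classically, with 1 as a dummy radius. *)
  have [/is_derivative_onP dV|ndV] := pselect (is_derivative_on E V (e + d) s).
    by have [d' d'0 d'P] := dV _ eps0; exists d'.
  by exists 1.
exists (Num.min r d'); first by rewrite lt_min r0.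
move=> x xE; rewrite lt_min => /andP[xr xd'].
have Qx := Qs x xE.
have nx : 0 <= eps * `|x - e| by rewrite mulr_ge0 // ltW.
rewrite ler_norml; case: (lo x xE xr) => [Qx'|[dV xdE Qx']].
  by apply/andP; split; lra.
have := d'P dV _ xdE; have -> : x + d - (e + d) = x - e by ring.
by move=> /(_ xd'); rewrite ler_norml => /andP[? ?]; apply/andP; split; lra.
Qed.

(** * The one-stage problem and weak duality *)

Record storage_stage (R : realType) (P E c price etap etab : R)
    (V Q : R -> R) : Prop := StorageStage {
  stage_power : 0 < P;
  stage_cost : 0 <= c;
  stage_etap : 0 < etap <= 1;
  stage_etab : 0 < etab <= 1;
  stage_concave : concave_on `[0, E] V;
  stage_max : forall x : R, 0 <= x <= E ->
    is_max (stage_profits P E c price etap etab V x) (Q x) }.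

(** Lower bounds on [Q] come from actions in one direction only. They are indexed by the target [y],
    since the derivative proofs hold fixed or translate the target. *)
Lemma charge_profit (R : realType) (P E c price etap etab : R) (V Q : R -> R)
    (x y : R) :
  storage_stage P E c price etap etab V Q ->
  0 <= x <= E -> 0 <= y <= E -> x <= y <= x + P * etab ->
  V y - price / etab * (y - x) <= Q x.
Proof.
move=> st xE yE xy; have [_ maxQ] := stage_max st xE.
have P0 := stage_power st; have /andP[h0 h1] := stage_etab st.
have soc : next_soc etap etab x ((y - x) / etab) 0 = y.
  by rewrite /next_soc divfK ?gt_eqF//; ring.
apply: maxQ; exists ((y - x) / etab), 0; split; first split => //.
- by rewrite divr_ge0 ?ler_pdivrMr//=; lra.
- by lra.
- by rewrite soc.
- by rewrite soc; ring.
Qed.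

Lemma discharge_profit (R : realType) (P E c price etap etab : R)
    (V Q : R -> R) (x y : R) :
  storage_stage P E c price etap etab V Q -> 0 <= price ->
  0 <= x <= E -> 0 <= y <= E -> x - P / etap <= y <= x ->
  V y + (price - c) * etap * (x - y) <= Q x.
Proof.
move=> st pr0 xE yE xy; have [_ maxQ] := stage_max st xE.
have P0 := stage_power st; have /andP[a0 a1] := stage_etap st.
have soc : next_soc etap etab x 0 (etap * (x - y)) = y.
  by rewrite /next_soc mulrAC mulfV ?gt_eqF//; ring.
apply: maxQ; exists 0, (etap * (x - y)); split; first split => //.
- by lra.
- apply/andP; split; first by rewrite mulr_ge0 ?(ltW a0)//; lra.
  by rewrite mulrC -ler_pdivlMr//; case/andP: xy; lra.
- by rewrite ltNge pr0.
- by rewrite soc.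
- by rewrite soc; ring.
Qed.

(* With s as the multiplier of the state-of-charge equation, the left-hand side
   is the action-dependent part of the Lagrangian of the stage problem. *)
Definition dual_bound (R : realType) (P c price etap etab s K : R) : Prop :=
  forall b p : R, 0 <= b <= P -> 0 <= p <= P -> (price < 0 -> p = 0) ->
    b * (s * etab - price) + p * (price - c - s / etap) <= K.

(** Weak duality, evaluated at the target [y] of an optimal action. The range of [y] is kept because
    the partial-power cases need to know that [y] is reachable. *)
Lemma stage_profit_le (R : realType) (P E c price etap etab : R)
    (V Q : R -> R) (s K x : R) :
  storage_stage P E c price etap etab V Q -> dual_bound P c price etap etab s K ->
  0 <= x <= E ->
  exists y, [/\ 0 <= y <= E, x - P / etap <= y <= x + P * etab
              & Q x <= K + V y - s * (y - x)].
Proof.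
move=> st dual xE; have [[b [p [[bP pP p0 yE] ->]]] _] := stage_max st xE.
have /andP[a0 a1] := stage_etap st; have /andP[h0 h1] := stage_etab st.
exists (next_soc etap etab x b p); split => //.
  have pa : 0 <= p / etap <= P / etap.
    by case/andP: pP => p1 p2; rewrite divr_ge0 ?(ltW a0)//= ler_pM2r ?invr_gt0.
  have bh : 0 <= b * etab <= P * etab.
    by case/andP: bP => b1 b2; rewrite mulr_ge0 ?(ltW h0)//= ler_pM2r.
  by rewrite /next_soc; lra.
have := dual b p bP pP p0; rewrite /next_soc.
have -> : s * (x - p / etap + b * etab - x) = b * (s * etab) - p * (s / etap).
  by ring.
by lra.
Qed.

(** Weak duality at [x] and the supergradient of [V] at [y] use the same slope [s], so the unknown
    target from [x] cancels. *)
Lemma stage_supergradient (R : realType) (P E c price etap etab : R)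
    (V Q : R -> R) (s K y e : R) :
  storage_stage P E c price etap etab V Q -> dual_bound P c price etap etab s K ->
  supergradient E V y s -> K + V y - s * (y - e) <= Q e -> supergradient E Q e s.
Proof.
move=> st dual Vs Qe x xE; have [z [zE _ Qx]] := stage_profit_le st dual xE.
by have := Vs z zE; lra.
Qed.

(** * Full charge, idling and full discharge: the slope of [V] at the target is the multiplier *)

(** If the target is exactly [E], starts to the right of [e] cannot charge fully. The last
    hypothesis then forces [price = v1 * etab], so the value lost by charging less equals the cost
    saved. *)
Lemma full_charge_derivative (R : realType) (P E c price etap etab : R)
    (V Q : R -> R) (e v1 : R) :
  storage_stage P E c price etap etab V Q -> 0 <= e -> e + P * etab <= E ->
  is_derivative_on E V (e + P * etab) v1 -> price <= v1 * etab ->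
  (e + P * etab = E -> v1 * etab <= price) ->
  is_derivative_on E Q e v1.
Proof.
move=> st e0 yE dV pv full; have P0 := stage_power st.
have /andP[a0 a1] := stage_etap st; have /andP[h0 h1] := stage_etab st.
have Ph := mulr_gt0 P0 h0; have c0 := stage_cost st.
pose K := P * (v1 * etab - price).
have dual : dual_bound P c price etap etab v1 K.
  move=> b p bP pP p0.
  have bK : b * (v1 * etab - price) <= K by rewrite ler_wpM2r//; lra.
  (* Discharging does not pay: for [price >= 0] one has [price <= v1 * etab <= v1 <= v1 / etap] by
     the round-trip losses, and a negative price forces [p = 0]. *)
  suff : p * (price - c - v1 / etap) <= 0 by lra.
  have [/p0->|pr0] := ltP price 0; first by rewrite mul0r.
  rewrite mulr_ge0_le0//; first by lra.
  have v10 : 0 <= v1 by rewrite -(pmulr_lge0 _ h0); lra.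
  have : v1 * etab <= v1 by rewrite ler_piMr.
  have : v1 <= v1 / etap by rewrite ler_pdivlMr// ler_piMr.
  by lra.
have eE : 0 <= e <= E by lra.
have y1E : 0 <= e + P * etab <= E by lra.
have Vs := concave_supergradient (stage_concave st) y1E dV.
have Qy x : 0 <= x <= E -> x + P * etab <= E ->
    V (x + P * etab) - price * P <= Q x.
  move=> xE xyE; have zE : 0 <= x + P * etab <= E by lra.
  have xz : x <= x + P * etab <= x + P * etab by lra.
  have := charge_profit st xE zE xz.
  by rewrite addrAC subrr add0r mulrACA mulVf ?gt_eqF// mulr1.
have KE : K = v1 * (P * etab) - price * P by rewrite /K; ring.
have Qe : Q e = K + V (e + P * etab) - v1 * (e + P * etab - e).
  apply/eqP; rewrite eq_le; apply/andP; split.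
    have [z [zE _ Qz]] := stage_profit_le st dual eE.
    by have := Vs z zE; lra.
  by have := Qy e eE yE; lra.
(* Below capacity the radius keeps the translated target within [[0, E]]; at capacity any positive
   radius serves. *)
pose r := if e + P * etab < E then E - (e + P * etab) else P * etab.
have r0 : 0 < r by rewrite /r; case: (ltP (_ + _) E) => ?; lra.
apply: (derivative_sandwich (V := V) (d := P * etab) r0).
  by apply: (stage_supergradient st dual Vs); rewrite Qe.
move=> x xE; rewrite /r ltr_norml; case: (ltP (_ + _) E) => [yltE|Eley] /andP[_ xe].
  by right; split => //; [lra|have := Qy x xE ltac:(lra); lra].
have pE : price / etab = v1.
  have pv' : price = v1 * etab by have := full ltac:(lra); lra.
  by rewrite pv' mulfK ?gt_eqF.
have [xyE|xyE] := leP (x + P * etab) E.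
  by right; split => //; [lra|have := Qy x xE xyE; lra].
(* Charging from [x] only up to [E] follows the tangent line, because [price / etab = v1]. *)
left; have E0 : 0 <= E <= E by lra.
have xz : x <= E <= x + P * etab by lra.
have := charge_profit st xE E0 xz; rewrite pE.
rewrite Qe (_ : e + P * etab = E); last by lra.
have -> : K = 0.
  by rewrite /K -pE divfK ?gt_eqF// subrr mulr0.
by lra.
Qed.

Lemma idle_derivative (R : realType) (P E c price etap etab : R)
    (V Q : R -> R) (e v0 : R) :
  storage_stage P E c price etap etab V Q -> 0 <= e <= E ->
  is_derivative_on E V e v0 -> v0 * etab <= price ->
  (0 <= price -> price <= v0 / etap + c) ->
  is_derivative_on E Q e v0.
Proof.
move=> st eE dV pv idle; have P0 := stage_power st.
have /andP[h0 h1] := stage_etab st; have Ph := mulr_gt0 P0 h0.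
(* With multiplier [v0] neither charging nor discharging has a positive reduced profit, so the bound
   is 0. *)
have dual : dual_bound P c price etap etab v0 0.
  move=> b p bP pP p0.
  have : b * (v0 * etab - price) <= 0 by rewrite mulr_ge0_le0//; lra.
  suff : p * (price - c - v0 / etap) <= 0 by lra.
  have [/p0->|pr0] := ltP price 0; first by rewrite mul0r.
  by rewrite mulr_ge0_le0//; have := idle pr0; lra.
have Vs := concave_supergradient (stage_concave st) eE dV.
have Qx x : 0 <= x <= E -> V x <= Q x.
  move=> xE; have xx : x <= x <= x + P * etab by lra.
  by have := charge_profit st xE xE xx; rewrite subrr mulr0 subr0.
have Qe : Q e = V e.
  apply/eqP; rewrite eq_le; apply/andP; split; last exact: Qx.
  have [z [zE _ Qz]] := stage_profit_le st dual eE.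
  by have := Vs z zE; lra.
apply: (derivative_sandwich (V := V) (d := 0) ltr01).
  by apply: (stage_supergradient st dual Vs); rewrite Qe; lra.
by move=> x xE _; right; rewrite !addr0; split => //; have := Qx x xE; lra.
Qed.

Lemma full_discharge_derivative (R : realType) (P E c price etap etab : R)
    (V Q : R -> R) (e v2 : R) :
  storage_stage P E c price etap etab V Q -> e <= E -> 0 < e - P / etap ->
  is_derivative_on E V (e - P / etap) v2 -> 0 <= price ->
  v2 / etap + c <= price -> is_derivative_on E Q e v2.
Proof.
move=> st eE y0 dV pr0 pv; have P0 := stage_power st.
have /andP[a0 a1] := stage_etap st; have /andP[h0 h1] := stage_etab st.
have Pa : 0 < P / etap by rewrite divr_gt0.
have c0 := stage_cost st.
pose K := P * (price - c - v2 / etap).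
have dual : dual_bound P c price etap etab v2 K.
  move=> b p bP pP p0.
  have pK : p * (price - c - v2 / etap) <= K by rewrite ler_wpM2r//; lra.
  (* Charging does not pay: if [v2 >= 0], then [v2 * etab <= v2 / etap <= price]; if [v2 < 0], the
     nonnegative price suffices. *)
  suff : b * (v2 * etab - price) <= 0 by lra.
  rewrite mulr_ge0_le0//; first by lra.
  have [v20|v20] := leP 0 v2; last first.
    have : v2 * etab < 0 by rewrite nmulr_rlt0.
    by lra.
  have : v2 * etab <= v2 by rewrite ler_piMr.
  have : v2 <= v2 / etap by rewrite ler_pdivlMr// ler_piMr.
  by lra.
have eE' : 0 <= e <= E by lra.
have y2E : 0 <= e - P / etap <= E by lra.
have Vs := concave_supergradient (stage_concave st) y2E dV.
have Qy x : 0 <= x <= E -> 0 <= x - P / etap ->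
    V (x - P / etap) + (price - c) * P <= Q x.
  move=> xE x0; have zE : 0 <= x - P / etap <= E by lra.
  have xz : x - P / etap <= x - P / etap <= x by lra.
  have := discharge_profit st pr0 xE zE xz.
  have -> : x - (x - P / etap) = P / etap by ring.
  by rewrite -mulrA [etap * _]mulrC divfK ?gt_eqF.
have KE : K = (price - c) * P - v2 * (P / etap) by rewrite /K; ring.
have Qe : Q e = K + V (e - P / etap) - v2 * (e - P / etap - e).
  apply/eqP; rewrite eq_le; apply/andP; split.
    have [z [zE _ Qz]] := stage_profit_le st dual eE'.
    by have := Vs z zE; lra.
  by have := Qy e eE' (ltW y0); lra.
apply: (derivative_sandwich (V := V) (d := - (P / etap)) y0).
  by apply: (stage_supergradient st dual Vs); rewrite Qe.
move=> x xE; rewrite ltr_norml => /andP[ex _].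
right; split => //; first by lra.
by have := Qy x xE ltac:(lra); lra.
Qed.

(** * Partial power: the price fixes the multiplier *)

(** The slope [s = price / etab] makes charging neutral and satisfies [v1 < s <= v0]. The strict
    side excludes full power; the weak side allows the tie [y = e]. *)
Lemma partial_charge_derivative (R : realType) (P E c price etap etab : R)
    (V Q : R -> R) (e v0 : R) :
  storage_stage P E c price etap etab V Q -> 0 <= e <= E ->
  is_derivative_on E V e v0 -> price <= v0 * etab ->
  (e + P * etab <= E -> exists2 v1,
     is_derivative_on E V (e + P * etab) v1 & v1 * etab < price) ->
  is_derivative_on E Q e (price / etab).
Proof.
move=> st eE dV pv0 full; have P0 := stage_power st.
have /andP[a0 a1] := stage_etap st; have /andP[h0 h1] := stage_etab st.
have Ph := mulr_gt0 P0 h0; have c0 := stage_cost st.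
set s := price / etab; have sh : s * etab = price by rewrite divfK ?gt_eqF.
have sv0 : s <= v0 by rewrite ler_pdivrMr.
have sv1 v1 : v1 * etab < price -> v1 < s by rewrite ltr_pdivlMr.
have dual : dual_bound P c price etap etab s 0.
  move=> b p bP pP p0; rewrite sh subrr mulr0 add0r.
  have [/p0->|pr0] := ltP price 0; first by rewrite mul0r.
  rewrite mulr_ge0_le0//; first by lra.
  have s0 : 0 <= s by rewrite divr_ge0// ltW.
  have : s * etab <= s by rewrite ler_piMr.
  have : s <= s / etap by rewrite ler_pdivlMr// ler_piMr.
  by lra.
have V0 := concave_supergradient (stage_concave st) eE dV.
have Qe z : 0 <= z <= E -> e <= z <= e + P * etab -> V z - s * (z - e) <= Q e.
  exact: charge_profit st eE.
have ee : e <= e <= e + P * etab by lra.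
have [y [yE ey Qy]] : exists y, [/\ 0 <= y <= E, e <= y <= e + P * etab
    & Q e = V y - s * (y - e)].
  have [z [zE ez Qz]] := stage_profit_le st dual eE.
  have [e_z|z_e] := leP e z.
    have ez' : e <= z <= e + P * etab by lra.
    by exists z; split => //; have := Qe z zE ez'; lra.
  (* A target below [e] is no better than idling, since [V] has slope [v0 >= s] at [e]. *)
  exists e; split => //; have := Qe e eE ee; have := V0 z zE.
  have : (v0 - s) * (z - e) <= 0 by rewrite mulr_ge0_le0//; lra.
  by lra.
(* Within the charging range this is optimality of [y]; outside it, the slopes of [V] at the two
   ends of the range bracket [s]. *)
have Vs : supergradient E V y s.
  move=> z zE; have [z_e|e_z] := ltP z e.
    have := Qe e eE ee; have := V0 z zE.
    have : (v0 - s) * (z - e) <= 0 by rewrite mulr_ge0_le0//; lra.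
    by lra.
  have [z_y1|y1_z] := leP z (e + P * etab).
    have ez : e <= z <= e + P * etab by lra.
    by have := Qe z zE ez; lra.
  have y1E : 0 <= e + P * etab <= E by lra.
  have [v1 dV1 /sv1 v1s] := full ltac:(lra).
  have := concave_supergradient (stage_concave st) y1E dV1 zE.
  have ey1 : e <= e + P * etab <= e + P * etab by lra.
  have := Qe _ y1E ey1.
  have : (v1 - s) * (z - (e + P * etab)) <= 0 by rewrite mulr_le0_ge0//; lra.
  by lra.
have y_lt : y < e + P * etab.
  rewrite lt_neqAle; apply/andP; split; last by case/andP: ey.
  apply/eqP => yy1; have [v1 dV1 /sv1] := full ltac:(lra).
  rewrite ltNge => /negP; apply; rewrite -yy1 in dV1.
  by apply: (supergradient_le_derivative _ dV1 Vs); lra.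
pose r := if e < y then Num.min (y - e) (e + P * etab - y) else P * etab.
have r0 : 0 < r by rewrite /r; case: (ltP e y) => ?; rewrite ?lt_min; lra.
apply: (derivative_sandwich (V := V) (d := 0) r0).
  by apply: (stage_supergradient st dual Vs); rewrite Qy; lra.
move=> x xE; rewrite /r.
have charge : x <= y <= x + P * etab -> Q e + s * (x - e) <= Q x.
  by move=> /(charge_profit st xE yE); rewrite -/s; lra.
case: (ltP e y) => [e_y|y_e].
  rewrite lt_min !ltr_norml => /andP[/andP[_ xe] /andP[ex _]].
  by left; apply: charge; lra.
rewrite ltr_norml => /andP[ex xe].
have [x_e|e_x] := leP x e; first by left; apply: charge; lra.
right; rewrite !addr0.
have ye : y = e by lra.
(* A start to the right of [y = e] cannot reach [y] by charging, so it idles. There is room to the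
   right of [e], hence the supergradient [s] is at least [v0], and the tie is exact. *)
have -> : s = v0.
  apply: le_anti; rewrite sv0 /=; rewrite ye in Vs.
  by apply: (derivative_le_supergradient _ dV Vs); lra.
have xx : x <= x <= x + P * etab by lra.
split => //; have := charge_profit st xE xE xx.
by rewrite Qy ye; lra.
Qed.

(** The ties are reversed with respect to charging: [v0 < s <= v2]. Full power may be attained with
    [s = v2], while [y = e] is possible only for [e = 0]. *)
Lemma partial_discharge_derivative (R : realType) (P E c price etap etab : R)
    (V Q : R -> R) (e v0 : R) :
  storage_stage P E c price etap etab V Q -> 0 <= e <= E ->
  is_derivative_on E V e v0 -> 0 < price -> v0 / etap + c < price ->
  (0 <= e - P / etap -> exists2 v2,
     is_derivative_on E V (e - P / etap) v2 & price <= v2 / etap + c) ->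
  is_derivative_on E Q e ((price - c) * etap).
Proof.
move=> st eE dV pr0 pv0 full; have P0 := stage_power st.
have /andP[a0 a1] := stage_etap st; have /andP[h0 h1] := stage_etab st.
have Pa : 0 < P / etap by rewrite divr_gt0.
have c0 := stage_cost st.
set s := (price - c) * etap.
have sa : s / etap = price - c by rewrite mulfK ?gt_eqF.
have sv0 : v0 < s by rewrite -ltr_pdivrMr//; lra.
have sv2 v2 : price <= v2 / etap + c -> s <= v2.
  by move=> pv2; rewrite -ler_pdivlMr//; lra.
have dual : dual_bound P c price etap etab s 0.
  move=> b p bP pP p0; rewrite sa subrr mulr0 addr0.
  rewrite mulr_ge0_le0//; first by lra.
  have [s0|s0] := leP 0 s; last first.
    have : s * etab < 0 by rewrite nmulr_rlt0.
    by lra.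
  have : s * etab <= s by rewrite ler_piMr.
  have : s <= s / etap by rewrite ler_pdivlMr// ler_piMr.
  by lra.
have V0 := concave_supergradient (stage_concave st) eE dV.
have Qe z : 0 <= z <= E -> e - P / etap <= z <= e -> V z - s * (z - e) <= Q e.
  by move=> zE /(discharge_profit st (ltW pr0) eE zE); rewrite -/s; lra.
have ee : e - P / etap <= e <= e by lra.
have [y [yE ey Qy]] : exists y, [/\ 0 <= y <= E, e - P / etap <= y <= e
    & Q e = V y - s * (y - e)].
  have [z [zE ez Qz]] := stage_profit_le st dual eE.
  have [z_e|e_z] := leP z e.
    have ez' : e - P / etap <= z <= e by lra.
    by exists z; split => //; have := Qe z zE ez'; lra.
  exists e; split => //; have := Qe e eE ee; have := V0 z zE.
  have : (v0 - s) * (z - e) <= 0 by rewrite mulr_le0_ge0//; lra.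
  by lra.
have Vs : supergradient E V y s.
  move=> z zE; have [e_z|z_e] := ltP e z.
    have := Qe e eE ee; have := V0 z zE.
    have : (v0 - s) * (z - e) <= 0 by rewrite mulr_le0_ge0//; lra.
    by lra.
  have [y2_z|z_y2] := leP (e - P / etap) z.
    have ez : e - P / etap <= z <= e by lra.
    by have := Qe z zE ez; lra.
  have y2E : 0 <= e - P / etap <= E by lra.
  have [v2 dV2 /sv2 v2s] := full ltac:(lra).
  have := concave_supergradient (stage_concave st) y2E dV2 zE.
  have ey2 : e - P / etap <= e - P / etap <= e by lra.
  have := Qe _ y2E ey2.
  have : (v2 - s) * (z - (e - P / etap)) <= 0 by rewrite mulr_ge0_le0//; lra.
  by lra.
have y_e : 0 < e -> y < e.
  move=> e0; rewrite lt_neqAle; apply/andP; split; last by case/andP: ey.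
  apply/eqP => ye; rewrite ye in Vs.
  by have := @supergradient_le_derivative _ E V e v0 s ltac:(lra) dV Vs; lra.
(* Strictly inside the discharge range, the distance to its ends keeps [y] reachable. At either end
   the length of the range suffices. *)
pose r := if e - P / etap < y then
  (if y < e then Num.min (e - y) (y - (e - P / etap)) else P / etap)
  else P / etap.
have r0 : 0 < r.
  rewrite /r; case: (ltP _ y) => ? //.
  by case: (ltP y e) => ? //; rewrite lt_min; lra.
apply: (derivative_sandwich (V := V) (d := - (P / etap)) r0).
  by apply: (stage_supergradient st dual Vs); rewrite Qy; lra.
move=> x xE; rewrite /r.
have discharge : x - P / etap <= y <= x -> Q e + s * (x - e) <= Q x.
  by move=> /(discharge_profit st (ltW pr0) xE yE); rewrite -/s; lra.
case: (ltP _ y) => [y2_y|y_y2].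
  case: (ltP y e) => [ye|e_y].
    rewrite lt_min !ltr_norml => /andP[/andP[ex _] /andP[_ xe]].
    by left; apply: discharge; lra.
  rewrite ltr_norml => /andP[ex xe].
  left; apply: discharge.
  (* Here [y = e], so [e = 0] and every admissible [x] lies to the right of [y]. *)
  by have [/y_e|] := ltP 0 e; lra.
rewrite ltr_norml => /andP[ex xe].
have [x_e|e_x] := leP x e; first by left; apply: discharge; lra.
(* Starts above [e] can no longer reach [y]; they discharge at full power and translate the target,
   where [V] has slope [v2 = s]. *)
right; have yy2 : y = e - P / etap by lra.
have [v2 dV2 /sv2 v2s] := full ltac:(lra).
have -> : s = v2.
  apply: le_anti; rewrite v2s /=; rewrite yy2 in Vs.
  by apply: (derivative_le_supergradient _ dV2 Vs); lra.
have zE : 0 <= x - P / etap <= E by lra.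
have xz : x - P / etap <= x - P / etap <= x by lra.
split => //; have := discharge_profit st (ltW pr0) xE zE xz.
by rewrite -/s Qy yy2; lra.
Qed.

(** * Infinite marginal values and the five cases *)

Lemma marginal_value_below (R : realType) (E : R) (V : R -> R) (x : R)
    (l : \bar R) : x < 0 -> is_marginal_value E V x l -> l = +oo%E.
Proof. by rewrite /is_marginal_value => ->. Qed.

Lemma marginal_value_above (R : realType) (E : R) (V : R -> R) (x : R)
    (l : \bar R) : 0 <= x -> E < x -> is_marginal_value E V x l -> l = -oo%E.
Proof. by move=> x0 Ex; rewrite /is_marginal_value ltNge x0 Ex. Qed.

Lemma marginal_value_in (R : realType) (E : R) (V : R -> R) (x : R)
    (l : \bar R) : 0 <= x <= E -> is_marginal_value E V x l ->
  exists2 r : R, l = r%:E & is_derivative_on E V x r.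
Proof. by case/andP=> x0 xE; rewrite /is_marginal_value !ltNge x0 xE. Qed.

Lemma discharge_threshold_fin (R : realType) (c etap v : R) :
  discharge_threshold c etap v%:E = (Num.max (v / etap + c) 0)%:E.
Proof. by rewrite EFin_max. Qed.

Lemma discharge_threshold_pinfty (R : realType) (c etap : R) : 0 < etap ->
  discharge_threshold c etap +oo%E = +oo%E.
Proof.
by move=> a0; rewrite /discharge_threshold gt0_mulye ?lte_fin ?invr_gt0.
Qed.

(** The infinite slopes exclude infeasible full-power targets: [-oo] above [E] refutes the first
    test, and [+oo] below 0 makes the fourth test succeed. *)
Lemma stage_marginal_update (R : realType) (P E c price etap etab : R)
    (V Q : R -> R) (v : R -> \bar R) (e : R) :
  storage_stage P E c price etap etab V Q -> 0 <= e <= E ->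
  (forall y, y \in [:: e; e + P * etab; e - P / etap] ->
     is_marginal_value E V y (v y)) ->
  (price = 0 -> (0 <= v e * (etap^-1)%:E + c%:E)%E) ->
  (e + P * etab = E -> (v (e + P * etab)%R * etab%:E <= price%:E)%E) ->
  (e - P / etap = 0 ->
     (price%:E <= discharge_threshold c etap (v (e - P / etap)%R))%E) ->
  exists q : R, is_derivative_on E Q e q /\
    q%:E = marginal_update P c price etap etab v e.
Proof.
move=> st eE hv hzero hfull hempty; have P0 := stage_power st.
have /andP[a0 a1] := stage_etap st; have /andP[h0 h1] := stage_etab st.
have Ph := mulr_gt0 P0 h0; have Pa : 0 < P / etap by rewrite divr_gt0.
have [v0 v0E dV0] := marginal_value_in eE (hv e ltac:(by rewrite !inE eqxx)).
have hv1 := hv (e + P * etab) ltac:(by rewrite !inE eqxx orbT).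
have hv2 := hv (e - P / etap) ltac:(by rewrite !inE eqxx !orbT).
rewrite v0E in hzero; rewrite /marginal_update v0E.
case: ifPn => [pv1|]; last rewrite -ltNge => v1p.
  have yE : e + P * etab <= E.
    rewrite leNgt; apply/negP => yE; move: pv1.
    by rewrite (marginal_value_above _ yE hv1) ?gt0_mulNye ?lte_fin//; lra.
  have y1E : 0 <= e + P * etab <= E by lra.
  have [v1 v1E dV1] := marginal_value_in y1E hv1.
  rewrite v1E in pv1 hfull *.
  exists v1; split => //; apply: (full_charge_derivative st) => //.
  by case/andP: eE.
rewrite -EFinM lee_fin; case: ifPn => [pv0|]; last rewrite -ltNge => v0p.
  exists (price / etab); split => //.
  apply: (partial_charge_derivative st eE dV0 pv0) => yE.
  have y1E : 0 <= e + P * etab <= E by lra.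
  have [v1 v1E dV1] := marginal_value_in y1E hv1.
  by exists v1 => //; move: v1p; rewrite v1E.
rewrite discharge_threshold_fin lee_fin.
case: ifPn => [pidle|]; last rewrite -ltNge => idlep.
  exists v0; split => //; apply: (idle_derivative st eE dV0 (ltW v0p)).
  (* A positive price sees through the truncation of the threshold at 0. At price 0 the truncated
     test always holds although discharging is allowed, so [hzero] supplies the inequality. *)
  rewrite le_eqVlt => /predU1P[/esym pr0|pr0].
    by have := hzero pr0; rewrite pr0 lee_fin.
  by move: pidle; rewrite le_max => /orP[//|]; lra.
move: idlep; rewrite gt_max => /andP[idlep pr0].
case: ifPn => [pv2|]; last rewrite -ltNge => v2p.
  exists ((price - c) * etap); split => //.
  apply: (partial_discharge_derivative st eE dV0 pr0 idlep) => y0.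
  have y2E : 0 <= e - P / etap <= E by lra.
  have [v2 v2E dV2] := marginal_value_in y2E hv2.
  exists v2 => //; move: pv2; rewrite v2E discharge_threshold_fin lee_fin.
  by rewrite le_max => /orP[//|]; lra.
have y0 : 0 < e - P / etap.
  rewrite ltNge le_eqVlt; apply/negP => /predU1P[y0|y0].
    by have := hempty y0; rewrite leNgt v2p.
  by move: v2p; rewrite (marginal_value_below y0 hv2) discharge_threshold_pinfty.
have y2E : 0 <= e - P / etap <= E by lra.
have [v2 v2E dV2] := marginal_value_in y2E hv2.
move: v2p; rewrite v2E discharge_threshold_fin lte_fin gt_max.
move=> /andP[/ltW v2p _]; exists v2; split => //.
by apply: (full_discharge_derivative st _ y0 dV2 (ltW pr0) v2p); lra.
Qed.

Unset Implicit Arguments.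

Theorem mainTheorem1 (R : realType) (N T : nat) (P E c : R)
    (etap etab : R -> R) (price : nat -> 'I_N -> R)
    (rho : nat -> 'I_N -> 'I_N -> R)
    (Q : nat -> 'I_N -> R -> R -> R) (V : nat -> 'I_N -> R -> R)
    (hP : 0 < P) (hE : 0 < E) (hc : 0 <= c)
    (hap : affine_fun etap) (hab : affine_fun etab)
    (hetap : forall x, 0 <= x <= E -> 0 < etap x <= 1)
    (hetab : forall x, 0 <= x <= E -> 0 < etab x <= 1)
    (hrho0 : forall t i j, 0 <= rho t i j)
    (hrho1 : forall t i, \sum_(j < N) rho t i j = 1)
    (hDP : dynamic_program T P E c etap etab price rho Q V)
    (t : nat) (ht : (0 < t <= T)%N) (i : 'I_N)
    (hV : concave_on `[0, E] (V t i))
    (e : R) (he : 0 <= e <= E)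
    (v : R -> \bar R)
    (hv : forall y, y \in [:: e; e + P * etab e; e - P / etap e] ->
       is_marginal_value E (V t i) y (v y))
    (hzero : price t i = 0 -> (0 <= v e * ((etap e)^-1)%:E + c%:E)%E)
    (hfull : e + P * etab e = E ->
       (v (e + P * etab e)%R * (etab e)%:E <= (price t i)%:E)%E)
    (hempty : e - P / etap e = 0 ->
       ((price t i)%:E <=
          discharge_threshold c (etap e) (v (e - P / etap e)%R))%E) :
  exists q : R, is_derivative_on E (Q t.-1 i e) e q /\
    q%:E = marginal_update P c (price t i) (etap e) (etab e) v e.
Proof.
(* The efficiencies are frozen at [e], so the stage function is [Q t.-1 i e], varied only in its
   start. *)
apply: (@stage_marginal_update R P E c _ _ _ (V t i)) => //.
by split=> //; [exact: hetap|exact: hetab|move=> x xE; apply: hDP.1].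
Qed.
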